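(* Let $n>4$, let $R$ be a quasi-mean of $n$ matrices with $H:=\operatorname{RStab}(R)\le\mathfrak{S}_n$, and let $Q$ be a quasi-mean of $r=n!/|H|$ matrices. Suppose that $G:=\operatorname{RStab}(Q\circ R)$ contains the alternating group $\mathfrak{A}_n$. Then either $\operatorname{RStab}(Q)$ contains a subgroup isomorphic to $\mathfrak{A}_n$, or $\mathfrak{A}_n\le\operatorname{RStab}(R)$.
   Context: $\mathbb{P}_m$ is the set of Hermitian positive definite $m\times m$ matrices; $A\ge B$ means $A-B$ is positive semidefinite; $A\,\#\,B:=A(A^{-1}B)^{1/2}$. $\mathfrak{S}_n$ is the symmetric group on $\{1,\dots,n\}$ and $\mathfrak{A}_n$ its alternating subgroup. Quasi-means. A quasi-mean of $n$ matrices is a map $Q:(\mathbb{P}_m)^n\to\mathbb{P}_m$ such that: P1'': there are $\alpha_1,\dots,\alpha_n\in\mathbb{R}$ with $Q(A_1,\dots,A_n)=A_1^{\alpha_1}\cdots A_n^{\alpha_n}$ whenever the $A_i$ commute pairwise; P2'': there are $\alpha_1,\dots,\alpha_n\in\mathbb{R}$ with $Q(t_1A_1,\dots,t_nA_n)=t_1^{\alpha_1}\cdots t_n^{\alpha_n}Q(A_1,\dots,A_n)$ for all $t_i>0$; P4: $A_i\ge A_i'$ for all $i$ implies $Q(A_1,\dots,A_n)\ge Q(A_1',\dots,A_n')$; P6: $Q(S^*A_1S,\dots,S^*A_nS)=S^*Q(A_1,\dots,A_n)S$ for nonsingular $S$; P7: $Q(\lambda A_1+(1-\lambda)B_1,\dots,\lambda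 A_n+(1-\lambda)B_n)\ge\lambda Q(A_1,\dots,A_n)+(1-\lambda)Q(B_1,\dots,B_n)$ for $\lambda\in[0,1]$; P8: $Q(A_1,\dots,A_n)^{-1}=Q(A_1^{-1},\dots,A_n^{-1})$; P9': for all $d>0$, if $\det A_i=d$ for all $i$ then $\det Q(A_1,\dots,A_n)=d$. Action. $(Q\sigma)(A_1,\dots,A_n):=Q(A_{\sigma(1)},\dots,A_{\sigma(n)})$; products of permutations are read left to right (i.e. $(\sigma\tau)(i)=\tau(\sigma(i))$), so that $(Q\sigma)\tau=Q(\sigma\tau)$ is a right action. $\operatorname{Stab}(Q):=\{\sigma:Q\sigma=Q\}$. Composition: $(Q\circ(R_1,\dots,R_r))(\underline A):=Q(R_1(\underline A),\dots,R_r(\underline A))$. Reductive symmetries. The symmetry $A\,\#\,B=B\,\#\,A$ of the two-matrix mean is reductive; the symmetry of $Q\circ(R_1,\dots,R_r)$ with respect to $\sigma$ is reductive if it can be formally proved relying only on the reductive symmetries of $Q$ and of $R_1,\dots,R_r$. $\operatorname{RStab}(M)$ is the subgroup of those $\sigma\in\operatorname{Stab}(M)$ for which $M=M\sigma$ is a reductive symmetry. Concretely, each quasi-mean comes with its subgroup $\operatorname{RStab}\le\operatorname{Stab}$, and $\sigma\in\operatorname{RStab}(Q\circ(R_1,\dots,R_r))$ means that there is $\tau\in\operatorname{RStab}(Q)$ such that, for every $i$, the identity $R_i\sigma=R_{\tau(i)}$ follows from the reductive symmetries of the $R_j$. The composite $Q\circ R$. Let $H=\operatorname{RStab}(R)$,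 $r=n!/|H|$, and let $\sigma_1,\dots,\sigma_r$ be a fixed transversal of the right cosets $H\sigma$ in $\mathfrak{S}_n$. Then $Q\circ R:=Q\circ(R\sigma_1,\dots,R\sigma_r)$. Here the identity $R\sigma_i\sigma=R\sigma_j$ follows from the reductive symmetries of $R$ exactly when $H\sigma_i\sigma=H\sigma_j$. The homomorphism $\rho_H:\mathfrak{S}_n\to\mathfrak{S}_r$ is defined by $\rho_H(\sigma)=\tau$, where $H\sigma_i\sigma=H\sigma_{\tau(i)}$ for all $i$; thus $\operatorname{RStab}(Q\circ R)=\{\sigma\in\mathfrak{S}_n:\rho_H(\sigma)\in\operatorname{RStab}(Q)\}$. *)

(* Defs.v *)
From HB Require Import structures.
From mathcomp Require Import all_boot all_order all_algebra all_fingroup all_solvable.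
From mathcomp Require Import boolp reals exp.
From mathcomp Require Import complex.

Set Implicit Arguments.
Unset Strict Implicit.
Unset Printing Implicit Defensive.

Import Order.TTheory GRing.Theory Num.Theory.
Local Open Scope ring_scope.
Local Open Scope complex_scope.
Local Open Scope sesquilinear_scope.

Section PositiveDefinite.
Variables (R : realType) (m : nat).
Local Notation C := R[i].
Implicit Types A B S : 'M[C]_m.

Definition qform A (x : 'cV[C]_m) : C := (x^t* *m A *m x) 0 0.

(* In C, 0 < z means that z is real and positive. *)
Definition posdef A : bool :=
  (A \is hermsymmx) && `[< forall x, x != 0 -> 0 < qform A x >].

Definition possemidef A : bool :=
  (A \is hermsymmx) && `[< forall x, 0 <= qform A x >].

Definition loewner_le B A : bool := possemidef (A - B).

Record pdmx := Pdmx { pdval :> 'M[C]_m; pdvalP : posdef pdval }.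

HB.instance Definition _ := [isSub for pdval].
HB.instance Definition _ := [Choice of pdmx by <:].

(* The power P^-1 diag(d_i^alpha) P of A = P^-1 diag(d) P; it does not depend
   on the diagonalization chosen by spectralmx. *)
Definition pdpow (A : pdmx) (alpha : R) : 'M[C]_m :=
  invmx (spectralmx A)
  *m diag_mx (map_mx (fun z : C => (powR (complex.Re z) alpha)%:C) (spectral_diag A))
  *m spectralmx A.

Lemma hermE A : (A \is hermsymmx) = (A == A^t*).
Proof. by rewrite qualifE expr0 scale1r. Qed.

Lemma trmxCM k l p (A : 'M[C]_(k, l)) (B : 'M[C]_(l, p)) :
  (A *m B)^t* = B^t* *m A^t*.
Proof. by rewrite trmx_mul map_mxM. Qed.

Lemma conjC_real (t : R) : (t%:C)^*%R = t%:C.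
Proof. by apply/CrealP/complex_realP; exists t. Qed.

Lemma posdef_unit A : posdef A -> A \in unitmx.
Proof.
case/andP=> _ /asboolP hA; apply: contraT => nu.
have : kermx A != 0 by rewrite kermx_eq0 row_free_unit; exact: nu.
case/rowV0Pn => v /sub_kermxP vA v0.
have := hA (v^t*); rewrite /qform trmxCK vA mul0mx mxE ltxx => F.
suff : false by [].
apply: F; apply: contra_neq v0 => e.
by rewrite -[v]trmxCK e trmx0 map_mx0.
Qed.

Lemma posdef_congr S A : S \in unitmx -> posdef A -> posdef (S^t* *m A *m S).
Proof.
move=> uS /andP[]; rewrite hermE => /eqP hA /asboolP pA.
apply/andP; split.
  by rewrite hermE !trmxCM trmxCK -hA mulmxA.
apply/asboolP=> x x0.
have -> : qform (S^t* *m A *m S) x = qform A (S *m x).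
  by rewrite /qform trmxCM !mulmxA.
apply: pA; apply: contra_neq x0 => e.
by rewrite -(mulKmx uS x) e mulmx0.
Qed.

Lemma posdef_inv A : posdef A -> posdef (invmx A).
Proof.
move=> pA; have uA := posdef_unit pA.
have uV : invmx A \in unitmx by rewrite unitmx_inv.
have := posdef_congr uV pA; rewrite -mulmxA mulmxV // mulmx1.
case/andP: (pA) => + _; rewrite hermE => /eqP hA.
by rewrite trmx_inv map_invmx -hA.
Qed.

Lemma qformD A B x : qform (A + B) x = qform A x + qform B x.
Proof. by rewrite /qform mulmxDr mulmxDl mxE. Qed.

Lemma qformZ c A x : qform (c *: A) x = c * qform A x.
Proof. by rewrite /qform -scalemxAr -scalemxAl mxE. Qed.

Lemma posdef_scale (t : R) A : 0 < t -> posdef A -> posdef (t%:C *: A).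
Proof.
move=> t0 /andP[]; rewrite hermE => /eqP hA /asboolP pA.
apply/andP; split.
  by rewrite hermE linearZ /= map_mxZ /= conjC_real -hA.
by apply/asboolP=> x /pA; rewrite qformZ; apply: mulr_gt0; rewrite ltcR.
Qed.

Lemma posdefD A B : posdef A -> posdef B -> posdef (A + B).
Proof.
move=> /andP[]; rewrite hermE => /eqP hA /asboolP pA.
move=> /andP[]; rewrite hermE => /eqP hB /asboolP pB.
apply/andP; split; first by rewrite hermE linearD /= map_mxD -hA -hB.
by apply/asboolP=> x x0; rewrite qformD addr_gt0 ?pA ?pB.
Qed.

Lemma posdef_conv (l : R) A B : 0 <= l <= 1 -> posdef A -> posdef B ->
  posdef (l%:C *: A + (1 - l)%:C *: B).
Proof.
case/andP; rewrite le_eqVlt => /orP[/eqP <- _ _ pB|l0].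
  by rewrite scale0r add0r subr0 scale1r.
rewrite le_eqVlt => /orP[/eqP -> pA _|l1 pA pB].
  by rewrite subrr scale0r addr0 scale1r.
by apply: posdefD; apply: posdef_scale; rewrite ?subr_gt0.
Qed.

Definition pd_congr S (hS : S \in unitmx) (A : pdmx) : pdmx :=
  Pdmx (posdef_congr hS (pdvalP A)).

Definition pd_inv (A : pdmx) : pdmx := Pdmx (posdef_inv (pdvalP A)).

Definition pd_scale (t : R) (ht : 0 < t) (A : pdmx) : pdmx :=
  Pdmx (posdef_scale ht (pdvalP A)).

Definition pd_conv (l : R) (hl : 0 <= l <= 1) (A B : pdmx) : pdmx :=
  Pdmx (posdef_conv hl (pdvalP A) (pdvalP B)).

End PositiveDefinite.

Section QuasiMean.
Variables (R : realType) (m n : nat).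
Local Notation P := (pdmx R m).

Record quasi_mean (Q : ('I_n -> P) -> P) : Prop := QuasiMean {
  qm_P1 : exists alpha : 'I_n -> R, forall A : 'I_n -> P,
    (forall i j, comm_mx (A i) (A j)) ->
    Q A = \prod_(i < n) pdpow (A i) (alpha i) :> 'M[R[i]]_m;
  qm_P2 : exists alpha : 'I_n -> R,
    forall (t : 'I_n -> R) (ht : forall i, 0 < t i) (A : 'I_n -> P),
    Q (fun i => pd_scale (ht i) (A i))
    = (\prod_(i < n) powR (t i) (alpha i))%:C *: (Q A : 'M[R[i]]_m)
      :> 'M[R[i]]_m;
  qm_P4 : forall A A' : 'I_n -> P,
    (forall i, loewner_le (A' i) (A i)) -> loewner_le (Q A') (Q A);
  qm_P6 : forall (S : 'M[R[i]]_m) (hS : S \in unitmx) (A : 'I_n -> P),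
    Q (fun i => pd_congr hS (A i)) = pd_congr hS (Q A);
  qm_P7 : forall (l : R) (hl : 0 <= l <= 1) (A B : 'I_n -> P),
    loewner_le (pd_conv hl (Q A) (Q B)) (Q (fun i => pd_conv hl (A i) (B i)));
  qm_P8 : forall A : 'I_n -> P, pd_inv (Q A) = Q (fun i => pd_inv (A i));
  qm_P9 : forall (d : R) (A : 'I_n -> P), 0 < d ->
    (forall i, \det (A i) = d%:C) -> \det (Q A) = d%:C }.

(* Since (s * t) i = t (s i) in {perm _}, this is a right action. *)
Definition qact (Q : ('I_n -> P) -> P) (s : 'S_n) : ('I_n -> P) -> P :=
  fun A => Q (fun i => A (s i)).

Lemma qactM Q (s t : 'S_n) : qact Q (s * t)%g = qact (qact Q s) t.
Proof. by apply/funext=> A; congr Q; apply/funext=> i; rewrite permM. Qed.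

Lemma qact1 Q : qact Q 1%g = Q.
Proof. by apply/funext=> A; congr Q; apply/funext=> i; rewrite perm1. Qed.

Definition Stab (Q : ('I_n -> P) -> P) : {set 'S_n} :=
  [set s | `[< qact Q s = Q >]].

Lemma StabP Q s : reflect (qact Q s = Q) (s \in Stab Q).
Proof. by rewrite inE; apply: asboolP. Qed.

Lemma Stab_group_set Q : group_set (Stab Q).
Proof.
apply/group_setP; split=> [|s t /StabP hs /StabP ht]; apply/StabP.
  exact: qact1.
by rewrite qactM hs.
Qed.

Canonical Stab_group Q := Group (Stab_group_set Q).

(* Which symmetries of a map are reductive depends on how the map was
   constructed, not only on the map itself, so RStab is part of the data. *)
Record rmap := RMap {
  rmap_fun :> ('I_n -> P) -> P;
  RStab : {group 'S_n};
  RStab_sub : RStab \subset Stab rmap_fun }.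

End QuasiMean.

Section RightCosets.
Local Open Scope group_scope.
Variables (n r : nat) (H : {group 'S_n}).

Record coset_transversal := CosetTransversal {
  tv :> 'I_r -> 'S_n;
  tv_inj : injective (fun i => H :* tv i);
  tv_cover : forall s : 'S_n, exists i, H :* s == H :* tv i }.

Variable T : coset_transversal.

Definition rho_fun (s : 'S_n) (i : 'I_r) : 'I_r := xchoose (tv_cover T (T i * s)).

Lemma rho_funP s i : H :* (T i * s) = H :* T (rho_fun s i).
Proof. exact/eqP/(xchooseP (tv_cover T (T i * s))). Qed.

Lemma rho_fun_inj s : injective (rho_fun s).
Proof.
move=> i j e; apply: (@tv_inj T); apply: (can_inj (rcosetK s)).
by rewrite -!rcosetM !rho_funP e.
Qed.

Definition rho (s : 'S_n) : 'S_r := perm (@rho_fun_inj s).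

Lemma rhoP s i : H :* (T i * s) = H :* T (rho s i).
Proof. by rewrite permE rho_funP. Qed.

Lemma rho_morphM : {in setT &, {morph rho : s t / s * t}}.
Proof.
move=> s t _ _; apply/permP=> i; apply: (@tv_inj T).
by rewrite -rhoP permM -rhoP mulgA !rcosetM -rhoP rcosetM.
Qed.

Canonical rho_morphism := Morphism rho_morphM.

End RightCosets.

Section Composition.
Variables (R : realType) (m n r : nat).
Local Notation P := (pdmx R m).

Definition compose (Q : ('I_r -> P) -> P) (Rs : 'I_r -> ('I_n -> P) -> P) :
  ('I_n -> P) -> P := fun A => Q (fun j => Rs j A).

Variables (Q : rmap R m r) (M : rmap R m n) (T : coset_transversal r (RStab M)).

Definition comp_fun : ('I_n -> P) -> P := compose Q (fun j => qact M (T j)).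

Definition comp_RStab : {group 'S_n} := [group of (rho T @*^-1 RStab Q)%g].

(* The defining description: some tau in RStab(Q) permutes the identities
   M sigma_i sigma = M sigma_(tau i), each of which follows from RStab(M)
   exactly when the two cosets agree. *)
Lemma comp_RStabP s :
  reflect (exists2 tau : 'S_r, tau \in RStab Q
             & forall i, (RStab M :* (T i * s) = RStab M :* T (tau i))%g)
          (s \in comp_RStab).
Proof.
apply: (iffP idP) => [|[tau hQ htau]].
  by rewrite !inE /= => h; exists (rho T s) => // i; exact: rhoP.
suff -> : s \in (rho T @*^-1 RStab Q)%g by [].
rewrite !inE /=; suff -> : rho T s = tau by [].
by apply/permP=> i; apply: (@tv_inj _ _ _ T); rewrite -rhoP htau.
Qed.

Lemma comp_RStab_sub : comp_RStab \subset Stab comp_fun.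
Proof.
apply/subsetP=> s /comp_RStabP[tau hQ htau]; apply/StabP/funext=> A.
have /StabP hQt := subsetP (RStab_sub Q) _ hQ.
rewrite /comp_fun /compose -{2}hQt /qact; congr (rmap_fun Q _); apply/funext=> i.
have : (T i * s)%g \in (RStab M :* T (tau i))%g by rewrite -htau rcoset_refl.
case/rcosetP=> h hH e.
have /StabP hM := subsetP (RStab_sub M) _ hH.
transitivity (qact M (T i * s)%g A); first by rewrite qactM.
by rewrite e qactM hM.
Qed.

Definition mean_comp : rmap R m n := RMap comp_RStab_sub.

End Composition.

(* Main.v *)
(* Since 'Alt_('I_n) is simple for n > 4, the restriction of [rho] to it is
   either injective, so that its image is a copy of 'Alt_('I_n) in RStab(Q), or
   trivial, in which case 'Alt_('I_n) fixes the coset H itself and lies in H. *)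

Require Import Defs.
From mathcomp Require Import all_boot all_order all_algebra all_fingroup all_solvable.
From mathcomp Require Import reals complex.

(** The transversal need not contain 1, but some [T i] represents the coset [H] itself; a kernel
    element [s] fixes that coset, so [H :* s = H]. *)
Lemma ker_rho_sub {n r : nat} {H : {group 'S_n}} (T : coset_transversal r H) :
  ('ker (rho T) \subset H)%g.
Proof.
apply/subsetP=> s /mker rho_s1.
have [i /eqP] := tv_cover T 1%g; rewrite rcoset1 => HTi.
have := rhoP T s i; rewrite rho_s1 perm1 rcosetM -HTi => <-.
exact: rcoset_refl.
Qed.

Theorem theorem3p7 (K : realType) (m n r : nat) (hm : (0 < m)%N) (hn : (4 < n)%N)
    (R : rmap K m n) (hR : quasi_mean R)
    (hr : r = (n`! %/ #|RStab R|)%N)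
    (T : coset_transversal r (RStab R))
    (Q : rmap K m r) (hQ : quasi_mean Q)
    (hG : ('Alt_('I_n) \subset RStab (mean_comp Q T))%g) :
  (exists L : {group 'S_r}, L \subset RStab Q /\ (L \isog 'Alt_('I_n))%g)
  \/ ('Alt_('I_n) \subset RStab R)%g.
Proof.
have subAT : ('Alt_('I_n) \subset [set: 'S_n])%g by exact: subsetT.
have /simpleP[_ simpleA] : simple 'Alt_('I_n) by apply: simple_Alt5; rewrite card_ord.
have nsKA : ('ker_('Alt_('I_n)) (rho T) <| 'Alt_('I_n))%g.
  exact: normalGI subAT (ker_normal _).
have [kerA1 | kerA] := simpleA _ nsKA; [left | right].
  (* [RStab (mean_comp Q T)] is by construction the preimage of [RStab Q] under [rho T], so [hG]
     bounds the image. *)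
  exists (rho T @* 'Alt_('I_n))%G; split; first by rewrite sub_morphim_pre.
  (* Pass through the quotient by 1, which is the kernel here, to use the first isomorphism
     theorem. *)
  rewrite isog_sym; apply: isog_trans (quotient1_isog _) _.
  by rewrite -kerA1; exact: first_isog_loc.
apply: subset_trans _ (ker_rho_sub T).
by apply/setIidPl; exact: kerA.
Qed.
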